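(* Let $a$ and $b$ be coprime nonzero integers and let $\ell=2^\beta d$ be a positive integer such that $d$ is odd and $\beta\ge 0$. Then the following hold. 1. If $ab$ is odd, then $\ell=2^\beta d\in EG_{(a,b)}$ if and only if one of the following statements holds: (a) $\beta\in\{0,1\}$ and $d=1$; (b) $\beta\in\{0,1\}$, $d\ge 3$, and there exists $s\ge 2$ such that $2^s\| \mathrm{ord}_p(\frac{a}{b})$ for every prime $p$ dividing $d$. 2. If $ab$ is even, then $\ell=2^\beta d\in EG_{(a,b)}$ if and only if one of the following statements holds: (a) $\beta=0$ and $d=1$; (b) $\beta=0$, $d\ge 3$, and there exists $s\ge 2$ such that $2^s\|\mathrm{ord}_p(\frac{a}{b})$ for every prime $p$ dividing $d$.
   Context: For coprime nonzero integers $a,b$, $EG_{(a,b)}$ denotes the set of positive integers $d$ such that $d\mid a^k+b^k$ for some even integer $k\ge 2$ (evenly-good integers). For a positive integer $n$ coprime to both $a$ and $b$, $\mathrm{ord}_n(\frac{a}{b})$ denotes the multiplicative order of $ab^{-1}$ in $(\mathbb{Z}/n\mathbb{Z})^\times$. The notation $2^s\| N$ means that $s$ is the largest integer with $2^s\mid N$. A condition of the form $2^s\|\mathrm{ord}_n(\frac{a}{b})$ is understood to include that $n$ is coprime to $ab$ (so that the order is defined). *)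

(* Defs.v *)
From HB Require Import structures.
From mathcomp Require Import all_boot all_order all_algebra all_fingroup.

Set Implicit Arguments.
Unset Strict Implicit.
Unset Printing Implicit Defensive.

Import GRing.Theory.

Local Open Scope ring_scope.

Definition EG (a b : int) (d : nat) : Prop :=
  (0 < d)%N /\
  exists k : nat, [/\ (2 <= k)%N, ~~ odd k & (d%:Z %| a ^+ k + b ^+ k)%Z].

(* Meaningful only for n > 0 coprime to a * b: otherwise the quotient in 'Z_n
   may fail to be a unit, and insubd then returns the unit 1. For n = 1, where
   'Z_1 is the ring Z/2, the unit group is still trivial and the order is 1. *)
Definition ord_frac (n : nat) (a b : int) : nat :=
  #[insubd (1%g : {unit 'Z_n}) (a%:~R / b%:~R : 'Z_n)%R]%g.

Definition exact_pow2 (s N : nat) : Prop :=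
  (2 ^ s %| N)%N /\ forall t : nat, (2 ^ t %| N)%N -> (t <= s)%N.

(* The condition includes that the order is defined. *)
Definition exact_pow2_ord (s n : nat) (a b : int) : Prop :=
  [/\ (0 < n)%N, coprimez n%:Z (a * b) & exact_pow2 s (ord_frac n a b)].

(* Main.v *)
(** For an odd prime p coprime to ab, p divides a^k + b^k iff a/b has k-th
    power -1 mod p, i.e. iff its order divides 2k but not k; this forces the
    2-part of the order to be exactly twice that of k, whence a common s over
    the primes dividing d.  Conversely, let m be the odd part of ord_d(a/b) and
    k = 2^(s-1) m, so that every prime p | d divides a^k + b^k.  With x = a^k
    and y = b^k, d divides x^(2^t) - y^(2^t) for large t, and in
    x^(2^t) - y^(2^t) = (x - y) (x + y) (x^2 + y^2) ... (x^(2^(t-1)) + y^(2^(t-1)))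
    all factors other than x + y are coprime to d, so d | x + y.  The prime 2
    is settled by even powers of odd integers being 1 mod 4. *)
Require Import Defs.
From HB Require Import structures.
From mathcomp Require Import all_boot all_order all_algebra all_fingroup.
From mathcomp Require Import cyclic.

Import GRing.Theory.

Local Open Scope ring_scope.

Lemma intr_Zp_eq0 (n : nat) (z : int) :
  (1 < n)%N -> (z%:~R == 0 :> 'Z_n) = (n%:Z %| z)%Z.
Proof.
move=> n1; rewrite dvdzE /=; have natE m : (m%:R == 0 :> 'Z_n) = (n %| m)%N.
  by rewrite -val_eqE /= val_Zp_nat.
by case: (intP z) => [|m|m]; rewrite ?rmorphN /= ?oppr_eq0 ?abszN natE.
Qed.

(** Coprimality makes [a] and [b] units mod [n], so [insubd] does not fall back on its default, and
    (a/b)^k = 1 can be multiplied through by the unit b^k. The bound 1 < n makes ['Z_n] the genuine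
    ring Z/n. *)
Lemma ord_frac_dvdn (n k : nat) (a b : int) :
  (1 < n)%N -> coprimez n (a * b) ->
  (ord_frac n a b %| k)%N = (n%:Z %| a ^+ k - b ^+ k)%Z.
Proof.
move=> n1; rewrite coprimezMr => /andP[na nb].
have unitZ z : coprimez n z -> z%:~R \is a @GRing.unit 'Z_n.
  rewrite coprimezE /=; case: (intP z) => [|m|m];
  by rewrite ?rmorphN /= ?unitrN ?abszN unitZpE.
rewrite order_dvdn -val_eqE /= FinRing.val_unitX.
rewrite insubdK ?unitr_div ?unitZ //; last first.
  by rewrite -topredE /= unitrM unitrV !unitZ.
rewrite expr_div_n -intr_Zp_eq0 // rmorphB !rmorphXn /= subr_eq0.
by rewrite -[LHS](inj_eq (mulIr (unitrX k (unitZ b nb)))) divrK ?mul1r // unitrX ?unitZ.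
Qed.

Lemma coprimez_primeE (p : nat) (z : int) :
  prime p -> coprimez p z = ~~ (p%:Z %| z)%Z.
Proof. by move=> pp; rewrite coprimezE prime_coprime. Qed.

Lemma Euclid_dvdzM (p : nat) (x y : int) : prime p ->
  (p%:Z %| x * y)%Z = (p%:Z %| x)%Z || (p%:Z %| y)%Z.
Proof. by move=> pp; rewrite !dvdzE abszM Euclid_dvdM. Qed.

Lemma Euclid_dvdzX (p k : nat) (x : int) : prime p ->
  (p%:Z %| x ^+ k)%Z = (p%:Z %| x)%Z && (0 < k)%N.
Proof. by move=> pp; rewrite !dvdzE abszX Euclid_dvdX. Qed.

Lemma coprimez_nat_prime (d : nat) (z : int) : (0 < d)%N ->
  (forall p : nat, prime p -> (p %| d)%N -> ~~ (p%:Z %| z)%Z) -> coprimez d z.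
Proof.
move=> d0 H; rewrite coprimezE /= /coprime; apply: contraT => g1.
have g0 : (0 < gcdn d `|z|)%N by rewrite gcdn_gt0 d0.
have pp : prime (pdiv (gcdn d `|z|)).
  by apply: pdiv_prime; case: (gcdn _ _) g0 g1 => [|[]].
have := pdiv_dvd (gcdn d `|z|); rewrite dvdn_gcd => /andP[pd pz].
by have := H _ pp pd; rewrite dvdzE pz.
Qed.

(** If [p] divided one of [a], [b], the sum would force it to divide a power of the other, hence
    both. *)
Lemma prime_dvd_sum_exp_coprime (p k : nat) (a b : int) : coprimez a b ->
  prime p -> (0 < k)%N -> (p%:Z %| a ^+ k + b ^+ k)%Z -> coprimez p (a * b).
Proof.
move=> hab pp k0 pab; rewrite coprimez_primeE // Euclid_dvdzM //.
have eqab : (p%:Z %| a)%Z = (p%:Z %| b)%Z.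
  transitivity (p%:Z %| a ^+ k)%Z; first by rewrite Euclid_dvdzX ?k0 ?andbT.
  transitivity (p%:Z %| b ^+ k)%Z; last by rewrite Euclid_dvdzX ?k0 ?andbT.
  by apply/idP/idP => H; [rewrite -(rpredDl _ H) | rewrite -(rpredDr _ H)].
rewrite eqab orbb; apply/negP => pb.
have : (p%:Z %| gcdz a b)%Z by rewrite dvdz_gcd eqab pb.
by rewrite (eqP hab) dvdz1 /= eqn_leq leqNgt prime_gt1.
Qed.

Lemma odd_expz_even_mod4 (a : int) (k : nat) :
  ~~ (2 %| a)%Z -> ~~ odd k -> (4 %| a ^+ k - 1)%Z.
Proof.
(* For even k, a^2 - 1 divides a^k - 1; with a = 2q + 1 one has a^2 - 1 = 4 (q^2 + q). *)
move=> a2 k2; rewrite -(even_halfK k2) -muln2 mulnC exprM -(expr1n _ k./2) subrXX.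
apply: dvdz_mulr; have [q ->] : exists q, a = q * 2 + 1.
  exists (a %/ 2)%Z; move: (divz_eq a 2) (@modz_ge0 a 2 isT) (@ltz_pmod a 2 isT).
  case: (a %% 2)%Z => [[|[|m]]|m] // aE _ _.
  by case/dvdzP: a2; exists (a %/ 2)%Z; rewrite {1}aE addr0.
apply/dvdzP; exists (q ^+ 2 + q); rewrite sqrrD mulrDl expr1n mulr1 addrK exprMn.
by rewrite -mulrnAr.
Qed.

Lemma sum_odd_expz_even_mod4 (a b : int) (k : nat) :
  ~~ (2 %| a * b)%Z -> ~~ odd k -> (4 %| a ^+ k + b ^+ k - 2)%Z.
Proof.
rewrite (Euclid_dvdzM 2) // negb_or => /andP[a2 b2] k_even.
rewrite -[X in _ - X]/(1 + 1) opprD addrACA.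
by apply: rpredD; apply: odd_expz_even_mod4.
Qed.

Lemma odd_prime_dvdz_double (p : nat) (z : int) :
  prime p -> odd p -> (p%:Z %| z *+ 2)%Z = (p%:Z %| z)%Z.
Proof.
move=> pp p_odd; rewrite -mulr_natr Euclid_dvdzM // orbC dvdzE /=.
by rewrite dvdn_prime2 //; case: eqP p_odd => // ->.
Qed.

Lemma exact_pow2_ord_of_dvd_sum (p k : nat) (a b : int) :
  prime p -> odd p -> coprimez p (a * b) -> (0 < k)%N ->
  (p%:Z %| a ^+ k + b ^+ k)%Z -> exact_pow2_ord (logn 2 k).+1 p a b.
Proof.
move=> pp p_odd pab k0 psum; split=> //; first exact: prime_gt0.
have ordE := ord_frac_dvdn _ _ _ _ (prime_gt1 pp) pab.
have dvd2k : (ord_frac p a b %| k * 2)%N.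
  by rewrite ordE !exprM subr_sqr mulrC dvdz_mulr.
have ndvdk : ~~ (ord_frac p a b %| k)%N.
  rewrite ordE; apply/negP => pdiff.
  (* Sum and difference add up to 2 a^k, which the odd prime [p] cannot divide. *)
  have := rpredD psum pdiff; rewrite addrACA subrr addr0 -mulr2n.
  rewrite odd_prime_dvdz_double // Euclid_dvdzX // k0 andbT; apply/negP.
  by move: pab; rewrite coprimezMr coprimez_primeE // => /andP[].
have ord0 : (0 < ord_frac p a b)%N by exact: order_gt0.
have [m m2 ordm] := @pfactor_coprime 2 _ isT ord0.
have log2k : logn 2 (k * 2) = (logn 2 k).+1 by rewrite lognM // addn1.
split=> [|t tord]; last by rewrite -log2k -pfactor_dvdn ?(dvdn_trans tord) ?muln_gt0 ?k0.
(* The odd part [m] of the order divides 2k, hence k. Were its 2-part also to divide k, the whole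
   order would. *)
rewrite pfactor_dvdn // ltnNge; apply: contra ndvdk => ord_le.
rewrite {1}ordm Gauss_dvd; last by rewrite coprimeXr // coprime_sym.
rewrite pfactor_dvdn // ord_le andbT -(@Gauss_dvdl _ _ 2) 1?coprime_sym //.
by apply: dvdn_trans dvd2k; rewrite {1}ordm dvdn_mulr.
Qed.

(** Induction on [t] peels off the last factor of the telescoping product. A prime of [d] dividing
    that factor also divides the complementary difference, a multiple of x + y, hence twice a power
    of [y]. In the base case the same argument removes x - y. *)
Lemma Gauss_dvdz_sum_pow2 (d t : nat) (x y : int) : odd d ->
  (forall p : nat, prime p -> (p %| d)%N ->
     (p%:Z %| x + y)%Z && ~~ (p%:Z %| y)%Z) ->
  (d%:Z %| x ^+ (2 ^ t.+1) - y ^+ (2 ^ t.+1))%Z -> (d%:Z %| x + y)%Z.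
Proof.
move=> d_odd dP; have d0 := odd_gt0 d_odd.
have ndvd2 p z (pp : prime p) (pd : (p %| d)%N) :=
  odd_prime_dvdz_double p z pp (dvdn_odd pd d_odd).
elim: t => [|t IH].
  rewrite expn1 subr_sqr Gauss_dvdzr //; apply: coprimez_nat_prime => // p pp pd.
  have /andP[pxy] := dP p pp pd; apply: contra => pdiff.
  by have := rpredB pxy pdiff; rewrite opprD opprK addrACA subrr add0r -mulr2n ndvd2.
move=> dvd_diff; apply: IH; move: dvd_diff; rewrite [(2 ^ t.+2)%N]expnSr !exprM subr_sqr.
rewrite Gauss_dvdzl //; apply: coprimez_nat_prime => // p pp pd.
have /andP[pxy] := dP p pp pd; apply: contra => psum.
have : (p%:Z %| x ^+ (2 ^ t.+1) - y ^+ (2 ^ t.+1))%Z.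
  by rewrite expnS !exprM subrXX dvdz_mulr // subr_sqr dvdz_mull.
move=> /(rpredB psum); rewrite opprD opprK addrACA subrr add0r -mulr2n ndvd2 //.
by rewrite Euclid_dvdzX // => /andP[].
Qed.

Lemma EG_of_exact_pow2_ord (s d : nat) (a b : int) :
  odd d -> (1 < d)%N -> (1 < s)%N ->
  (forall p : nat, prime p -> (p %| d)%N -> exact_pow2_ord s p a b) ->
  EG a b d.
Proof.
case: s => // s d_odd d1 s0 ordP; split; first exact: odd_gt0.
have dab : coprimez d (a * b).
  apply: coprimez_nat_prime => [|p pp pd]; first exact: odd_gt0.
  by have [_] := ordP p pp pd; rewrite coprimez_primeE.
have [m m2 ordm] := @pfactor_coprime 2 (ord_frac d a b) isT (order_gt0 _).
set v := logn 2 _ in ordm.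
(* Reducing from mod [d] to mod [p], the order at [p] divides the order at [d]. *)
have dvd_ord p : prime p -> (p %| d)%N -> (ord_frac p a b %| m * 2 ^ v)%N.
  move=> pp pd; have [_ pab _] := ordP p pp pd; rewrite -ordm ord_frac_dvdn ?prime_gt1 //.
  by apply: (@dvdz_trans d); rewrite -?ord_frac_dvdn.
(* The common exponent is now [s.+1], so this is the odd part of the order times half the common
   power of 2; it is even since s > 0. *)
exists (m * 2 ^ s)%N; split.
- have m0 : (0 < m)%N by apply: odd_gt0; rewrite -coprime2n.
  by rewrite (leq_trans _ (leq_pmull _ m0)) // (@leq_pexp2l 2 1 s isT s0).
- by rewrite oddM oddX; case: s s0 {ordP} => // s _; rewrite andbF.
(* Taking t = v suffices: the order m 2^v at [d] divides k 2^(v+1). *)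
set k := (m * 2 ^ s)%N; apply: (@Gauss_dvdz_sum_pow2 _ v) => [//|p pp pd|]; last first.
  by rewrite -!exprM -ord_frac_dvdn // ordm /k mulnAC dvdn_mulr // dvdn_mul // dvdn_exp2l.
have [_ pab [s_ord s_max]] := ordP p pp pd.
have ordE := ord_frac_dvdn _ _ _ _ (prime_gt1 pp) pab.
have ord0 : (0 < ord_frac p a b)%N by exact: order_gt0.
have nb : ~~ (p%:Z %| b)%Z.
  by move: pab; rewrite coprimezMr !coprimez_primeE // => /andP[].
rewrite Euclid_dvdzX // (negPf nb) andbT.
(* Otherwise 2^(s+1) would divide m 2^s with [m] odd. *)
have : ~~ (ord_frac p a b %| k)%N.
  apply/negP => /(dvdn_trans s_ord); rewrite expnSr mulnC dvdn_pmul2r ?expn_gt0 //.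
  by apply/negP; rewrite -prime_coprime.
(* The odd part of the order at [p] divides [m], and its 2-part divides 2^(s+1) by maximality. *)
have : (ord_frac p a b %| k * 2)%N.
  have [m' m'2 ordm'] := @pfactor_coprime 2 _ isT ord0.
  rewrite /k -mulnA -expnSr ordm' dvdn_mul //; last first.
    by rewrite dvdn_exp2l // s_max // pfactor_dvdnn.
  rewrite -(@Gauss_dvdl _ _ (2 ^ v)) ?coprimeXr 1?coprime_sym //.
  by apply: dvdn_trans (dvd_ord p pp pd); rewrite {1}ordm' dvdn_mulr.
rewrite !ordE !exprM subr_sqr Euclid_dvdzM // => /orP[->|] //.
Qed.

(** The same exponent works: for ab odd the sum is even, and 2 is coprime to [d]. *)
Lemma EG_double (a b : int) (d : nat) : ~~ (2 %| a * b)%Z -> odd d ->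
  EG a b d -> EG a b (2 * d).
Proof.
move=> ab2 d_odd [d0 [k [k2 k_even dk]]].
split; first by rewrite muln_gt0.
exists k; split=> //; rewrite PoszM Gauss_dvdz ?dk ?andbT ?coprimezE ?coprime2n //.
rewrite -[_ + _](subrK 2) rpredD //.
by apply: (@dvdz_trans 4) => //; apply: sum_odd_expz_even_mod4.
Qed.

Lemma exact_pow2_ord_of_EG (a b : int) (l d : nat) : coprimez a b ->
  EG a b l -> (d %| l)%N -> odd d ->
  exists2 s : nat, (2 <= s)%N &
    forall p : nat, prime p -> (p %| d)%N -> exact_pow2_ord s p a b.
Proof.
move=> hab [_ [k [k2 k_even lk]]] dl d_odd; have k0 : (0 < k)%N by apply: ltnW.
(* This value depends only on k, so it serves all primes of [d] at once; it is at least 2 because k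
   is even. *)
exists (logn 2 k).+1 => [|p pp pd].
  by rewrite ltnS -pfactor_dvdn // dvdn2.
have psum : (p%:Z %| a ^+ k + b ^+ k)%Z.
  by apply: dvdz_trans lk; rewrite dvdzE (dvdn_trans pd).
apply: exact_pow2_ord_of_dvd_sum => //; first exact: dvdn_odd pd d_odd.
exact: prime_dvd_sum_exp_coprime psum.
Qed.

Lemma EG_not_dvd2 (a b : int) (l : nat) : coprimez a b ->
  (2 %| a * b)%Z -> EG a b l -> ~~ (2 %| l)%N.
Proof.
move=> hab ab2 [_ [k [k2 _ lk]]]; apply/negP => l2.
have : coprimez 2%N (a * b).
  apply: (@prime_dvd_sum_exp_coprime 2 k) => //; first exact: ltnW.
  by apply: dvdz_trans lk.
by rewrite coprimez_primeE // ab2.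
Qed.

(** For ab odd and k even, a^k + b^k is 2 mod 4. *)
Lemma EG_not_dvd4 (a b : int) (l : nat) :
  ~~ (2 %| a * b)%Z -> EG a b l -> ~~ (4 %| l)%N.
Proof.
move=> ab2 [_ [k [_ k_even lk]]]; apply/negP => l4.
have : (4 %| a ^+ k + b ^+ k)%Z by apply: dvdz_trans lk.
by rewrite -[_ + _](subrK 2) rpredDl // sum_odd_expz_even_mod4.
Qed.

Lemma EG1 (a b : int) : EG a b 1.
Proof. by split=> //; exists 2%N; rewrite dvd1z. Qed.

Theorem theorem3p2 (a b : int) (l beta d : nat)
  (ha : a <> 0) (hb : b <> 0) (hab : coprimez a b)
  (hl0 : (0 < l)%N) (hl : l = (2 ^ beta * d)%N) (hd : odd d) :
  (~~ (2 %| a * b)%Z ->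
     (EG a b l <->
        ((beta = 0%N \/ beta = 1%N) /\ d = 1%N) \/
        [/\ beta = 0%N \/ beta = 1%N, (3 <= d)%N &
            exists2 s : nat, (2 <= s)%N &
              forall p : nat, prime p -> (p %| d)%N ->
                exact_pow2_ord s p a b])) /\
  ((2 %| a * b)%Z ->
     (EG a b l <->
        (beta = 0%N /\ d = 1%N) \/
        [/\ beta = 0%N, (3 <= d)%N &
            exists2 s : nat, (2 <= s)%N &
              forall p : nat, prime p -> (p %| d)%N ->
                exact_pow2_ord s p a b])).
Proof.
have d0 : (0 < d)%N := odd_gt0 hd.
have d_cases : d = 1%N \/ (3 <= d)%N.
  by case: d hd {hl d0} => [|[|[|d]]] // _; [left | right].
have dl : (d %| l)%N by rewrite hl dvdn_mull.
split=> ab2; split.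
- move=> EGl; have beta_le : beta = 0%N \/ beta = 1%N.
    case: beta hl => [|[|beta]] hl; [by left | by right |].
    (* Here the exponent of 2 is at least 2, so 4 would divide [l]. *)
    by case/negP: (EG_not_dvd4 _ _ _ ab2 EGl); rewrite hl !expnS mulnA -mulnA dvdn_mulr.
  case: d_cases => d3; [by left | right; split=> //].
  exact: exact_pow2_ord_of_EG hab EGl dl hd.
- move=> H; have [beta_le EGd] : (beta = 0%N \/ beta = 1%N) /\ EG a b d.
    case: H => [[beta_le ->]|[beta_le d3 [s s2 ordP]]]; split=> //; first exact: EG1.
    by apply: EG_of_exact_pow2_ord ordP => //; apply: ltnW.
  by rewrite hl; case: beta_le => ->; [rewrite mul1n | apply: EG_double].
- move=> EGl; have beta0 : beta = 0%N.
    case: beta hl => [|beta] hl //.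
    by case/negP: (EG_not_dvd2 _ _ _ hab ab2 EGl); rewrite hl expnS -mulnA dvdn_mulr.
  case: d_cases => d3; [by left | right; split=> //].
  exact: exact_pow2_ord_of_EG hab EGl dl hd.
- rewrite hl => -[[-> ->]|[-> d3 [s s2 ordP]]]; first exact: EG1.
  by rewrite mul1n; apply: EG_of_exact_pow2_ord ordP => //; apply: ltnW.
Qed.
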